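(* Let $X,Y,Z$ be pointed metric spaces, $0<p\le s\le\infty$ and $0<r\le p$. If $S\in\Pi^L_{(\mathfrak{m}^L(s;p),r)}(X,Y)$ and $T\in\Pi^L_{(s,\mathfrak{m}^L(s;s))}(Y,Z)$, then $T\circ S\in\Pi^L_{(p,\mathfrak{m}^L(r;r))}(X,Z)$. Moreover $$\pi^L_{(p,\mathfrak{m}^L(r;r))}(T\circ S)\le\pi^L_{(s,\mathfrak{m}^L(s;s))}(T)\cdot\pi^L_{(\mathfrak{m}^L(s;p),r)}(S).$$
   Context: For a metric space $X$ with base point $x_0$, $X^{\#}$ is the Banach space of real-valued Lipschitz functions on $X$ vanishing at $x_0$, with norm $Lip(\cdot)$ (the Lipschitz constant); $B_{X^{\#}}$ is its closed unit ball. $(\sigma,x',x'')$ denotes a finite sequence $(\sigma_j,x'_j,x''_j)_{j=1}^m$ in $\mathbb{R}\times X\times X$. Indices lie in $(0,\infty]$, $1/\infty=0$. Put $\|(\sigma,x',x'')|\ell_p\|=\big[\sum_j|\sigma_j|^p d_X(x'_j,x''_j)^p\big]^{1/p}$ and $\|(\sigma,x',x'')|\ell_p^{L,w}\|=\sup_{f\in B_{X^{\#}}}\big[\sum_j|\sigma_j|^p|f(x'_j)-f(x''_j)|^p\big]^{1/p}$ (sums replaced by suprema over $j$ if $p=\infty$). For $0<q\le s\le\infty$ let $s'(q)\in(0,\infty]$ be given by $\frac1{s'(q)}+\frac1s=\frac1q$, and put $\mathfrak{m}^L_{(s;q)}(\sigma,x',x'')=\inf_\tau\|\tau|\ell_{s'(q)}\|\,\|(\sigma/\tau,x',x'')|\ell_s^{L,w}\|$,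 the infimum over all $\tau=(\tau_j)$ with $\tau_j\in\mathbb{R}\setminus\{0\}$, where $\sigma/\tau=(\sigma_j/\tau_j)_j$. In particular $\mathfrak{m}^L_{(s;s)}(\sigma,x',x'')=\|(\sigma,x',x'')|\ell_s^{L,w}\|$. For $p\le q\le s$, a Lipschitz map $T:X\to Y$ is Lipschitz $(\mathfrak{m}^L(s;q),p)$-summing if there is $C\ge0$ with $\mathfrak{m}^L_{(s;q)}(\sigma,Tx',Tx'')\le C\,\|(\sigma,x',x'')|\ell_p^{L,w}\|$ for all finite sequences $(\sigma,x',x'')$; $\Pi^L_{(\mathfrak{m}^L(s;q),p)}(X,Y)$ is the class of all such maps and $\pi^L_{(\mathfrak{m}^L(s;q),p)}(T)$ is the infimum of such $C$. For $q\le s$ and $p\ge q$, a Lipschitz map $T:X\to Y$ is Lipschitz $(p,\mathfrak{m}^L(s;q))$-summing if there is $C\ge0$ with $\|(\sigma,Tx',Tx'')|\ell_p\|\le C\,\mathfrak{m}^L_{(s;q)}(\sigma,x',x'')$ for all finite sequences; $\Pi^L_{(p,\mathfrak{m}^L(s;q))}(X,Y)$ is the class of all such maps and $\pi^L_{(p,\mathfrak{m}^L(s;q))}(T)$ is the infimum of such $C$. *)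

(* Defs.v *)
From HB Require Import structures.
From mathcomp Require Import all_boot all_order all_algebra.
From mathcomp Require Import all_classical all_reals all_analysis.

Set Implicit Arguments.
Unset Strict Implicit.
Unset Printing Implicit Defensive.

Import Order.TTheory GRing.Theory Num.Theory.
Import numFieldNormedType.Exports.

Local Open Scope classical_set_scope.
Local Open Scope ring_scope.
Local Open Scope ereal_scope.

#[short(type="pointedMetricType")]
HB.structure Definition PointedMetric (R : numDomainType) :=
  {T of Metric R T & isPointed T}.

Section Lipschitz.
Context {R : realType}.

Definition lipschitz_bounds {X Y : metricType R} (f : X -> Y) : set R :=
  [set K : R | (0 <= K)%R /\
               forall x y, (mdist (f x) (f y) <= K * mdist x y)%R].

Definition is_lipschitz {X Y : metricType R} (f : X -> Y) : Prop :=
  lipschitz_bounds f !=set0.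

Definition Lip {X Y : metricType R} (f : X -> Y) : \bar R :=
  ereal_inf [set K%:E | K in lipschitz_bounds f].

(* The metric of the scalar field is carried by [R^o]: there
   [mdist a b = `|b - a|]. *)
Definition lip_dual (X : pointedMetricType R) : set (X -> R^o) :=
  [set f : X -> R^o | is_lipschitz f /\ f point = 0%R].

Definition lip_dual_ball (X : pointedMetricType R) : set (X -> R^o) :=
  [set f : X -> R^o | lip_dual f /\ Lip f <= 1].

End Lipschitz.

Section Norms.
Context {R : realType}.

(* A finite sequence (sigma, x', x'') of length m is given by three families
   indexed by 'I_m. Indices range over \bar R; only 0 < p is meaningful, and
   the value at p = -oo is junk. The base value 0 of the maximum only matters
   for the empty sequence. *)
Definition ell_norm (p : \bar R) (m : nat) (a : 'I_m -> R) : R :=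
  match p with
  | r%:E => ((\sum_(j < m) `|a j| `^ r) `^ r^-1)%R
  | +oo => (\big[Order.max/0]_(j < m) `|a j|)%R
  | -oo => 0%R
  end.

Definition ell_mdist {X : metricType R} (p : \bar R) (m : nat)
    (sigma : 'I_m -> R) (x' x'' : 'I_m -> X) : \bar R :=
  (ell_norm p (fun j => sigma j * mdist (x' j) (x'' j))%R)%:E.

Definition ell_weak {X : pointedMetricType R} (p : \bar R) (m : nat)
    (sigma : 'I_m -> R) (x' x'' : 'I_m -> X) : \bar R :=
  ereal_sup [set (ell_norm p (fun j => sigma j * (f (x' j) - f (x'' j)))%R)%:E
            | f in (@lip_dual_ball R X : set (X -> R))].

(* s'(q), the solution of 1/s'(q) + 1/s = 1/q; recall 0^-1 = +oo and
   +oo^-1 = 0 in \bar R, so that s'(q) = +oo when s = q. *)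
Definition conj_index (s q : \bar R) : \bar R := (q^-1 - s^-1)^-1.

Definition mixed_norm {X : pointedMetricType R} (s q : \bar R) (m : nat)
    (sigma : 'I_m -> R) (x' x'' : 'I_m -> X) : \bar R :=
  ereal_inf [set (ell_norm (conj_index s q) tau)%:E *
                 ell_weak s (fun j => sigma j / tau j)%R x' x''
            | tau in [set tau : 'I_m -> R | forall j, tau j != 0%R]].

End Norms.

Section Summing.
(* _m_p stands for the pair (m^L(s;q), p), and _p_m for (p, m^L(s;q)); the
   indices are listed in the same order. *)
Context {R : realType}.

Definition bounds_m_p {X Y : pointedMetricType R} (s q p : \bar R)
    (T : X -> Y) : set R :=
  [set C : R | (0 <= C)%R /\
    forall (m : nat) (sigma : 'I_m -> R) (x' x'' : 'I_m -> X),
      mixed_norm s q sigma (T \o x') (T \o x'')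
        <= C%:E * ell_weak p sigma x' x''].

Definition Pi_m_p (X Y : pointedMetricType R) (s q p : \bar R) :
    set (X -> Y) :=
  [set T | is_lipschitz T /\ bounds_m_p s q p T !=set0].

Definition pi_m_p {X Y : pointedMetricType R} (s q p : \bar R)
    (T : X -> Y) : \bar R :=
  ereal_inf [set C%:E | C in bounds_m_p s q p T].

Definition bounds_p_m {X Y : pointedMetricType R} (p s q : \bar R)
    (T : X -> Y) : set R :=
  [set C : R | (0 <= C)%R /\
    forall (m : nat) (sigma : 'I_m -> R) (x' x'' : 'I_m -> X),
      ell_mdist p sigma (T \o x') (T \o x'')
        <= C%:E * mixed_norm s q sigma x' x''].

Definition Pi_p_m (X Y : pointedMetricType R) (p s q : \bar R) :
    set (X -> Y) :=
  [set T | is_lipschitz T /\ bounds_p_m p s q T !=set0].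

Definition pi_p_m {X Y : pointedMetricType R} (p s q : \bar R)
    (T : X -> Y) : \bar R :=
  ereal_inf [set C%:E | C in bounds_p_m p s q T].

End Summing.

(* Main.v *)
Require Import Defs.
From mathcomp Require Import all_boot all_order all_algebra.
From mathcomp Require Import all_classical all_reals all_analysis.
Import Order.TTheory GRing.Theory Num.Theory.

Set Implicit Arguments.
Unset Strict Implicit.
Unset Printing Implicit Defensive.

(** The theorem rests on the generalized Hölder inequality [ell_norm_mul]: if
    1/q + 1/s = 1/p, then the l_p norm of a pointwise product is at most the
    product of the l_q and l_s norms.

    Let C_S and C_T be admissible constants for S and T, and let
    (sigma, x', x'') be a finite sequence in X. For nonvanishing weights tau,
    writing sigma = tau (sigma / tau) and applying Hölder gives
      ||(sigma, TSx', TSx'')|l_p||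
        <= ||tau|l_q|| ||(sigma/tau, TSx', TSx'')|l_s||
        <= C_T ||tau|l_q|| ||(sigma/tau, Sx', Sx'')|l_s^w||,
    where the last step applies T to the reweighted sequence. The infimum over
    tau of the last product is by definition C_T times the mixed norm
    m_(s;p)(sigma, Sx', Sx''), so T satisfies a (p, m(s;p)) estimate
    ([bounds_p_m_mixed]). The hypothesis on S bounds this mixed norm by
    C_S ||(sigma, x', x'')|l_r^w||, and the weak norm is m_(r;r). Thus C_T C_S
    is admissible for T \o S. Taking infima over C_T and C_S separately gives
    the bound on the norms ([le_mul_ereal_inf]). *)

Local Open Scope classical_set_scope.
Local Open Scope ring_scope.
Local Open Scope ereal_scope.

(** * Hölder's inequality for finite sequences *)

(** Induction on the length: the last term is merged with the bound for the
    others by the two-term inequality [hoelder2]. *)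
Lemma hoelder_sum (R : realType) (p q : R) (m : nat) (a b : 'I_m -> R) :
  (0 < p)%R -> (0 < q)%R -> (p^-1 + q^-1 = 1)%R ->
  (forall j, 0 <= a j)%R -> (forall j, 0 <= b j)%R ->
  (\sum_(j < m) a j * b j <=
   (\sum_(j < m) a j `^ p) `^ p^-1 * (\sum_(j < m) b j `^ q) `^ q^-1)%R.
Proof.
move=> p0 q0 pq; elim: m a b => [|m IH] a b a0 b0.
  by rewrite big_ord0 mulr_ge0 ?powR_ge0.
rewrite !big_ord_recr /=.
set A := (\sum_(i < m) _ `^ p)%R; set B := (\sum_(i < m) _ `^ q)%R.
have A0 : (0 <= A)%R by apply: sumr_ge0 => i _; exact: powR_ge0.
have B0 : (0 <= B)%R by apply: sumr_ge0 => i _; exact: powR_ge0.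
have powRVK (x t : R) : (0 < t -> 0 <= x -> (x `^ t^-1) `^ t = x)%R.
  by move=> t0 x0; rewrite -powRrM mulVf ?gt_eqF// powRr1.
apply: (@le_trans _ _ (A `^ p^-1 * B `^ q^-1 + a ord_max * b ord_max)%R).
  by rewrite lerD2r; apply: IH => i.
rewrite -[X in (_ <= (X + _) `^ _ * _)%R](powRVK _ p)//.
rewrite -[X in (_ <= _ * (X + _) `^ _)%R](powRVK _ q)//.
by apply: hoelder2; rewrite ?powR_ge0.
Qed.

Lemma ell_norm_ge0 (R : realType) (p : \bar R) (m : nat) (a : 'I_m -> R) :
  (0 <= ell_norm p a)%R.
Proof. by case: p => [p| |] /=; rewrite ?powR_ge0 ?bigmax_ge_id. Qed.

Lemma le_ell_normy (R : realType) (m : nat) (a : 'I_m -> R) (j : 'I_m) :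
  (`|a j| <= ell_norm +oo a)%R.
Proof. exact: (le_bigmax _ (fun i => `|a i|%R)). Qed.

Lemma ell_normyM (R : realType) (p : \bar R) (m : nat) (a b : 'I_m -> R) :
  0 < p ->
  (ell_norm p (fun j => a j * b j) <= ell_norm +oo a * ell_norm p b)%R.
Proof.
have M0 := @ell_norm_ge0 R +oo m a; have aM := @le_ell_normy R m a.
set M := ell_norm +oo a in M0 aM *.
case: p => [p| |] //= p0; last first.
  apply: bigmax_le => [|j _].
    by rewrite mulr_ge0// bigmax_ge_id.
  by rewrite normrM ler_pM// (le_bigmax _ (fun i => `|b i|%R)).
rewrite lte_fin in p0.
(* Write M = (M ^ p) ^ (1/p), to compare the sums under the root. *)
rewrite -[X in (X * _)%R](@powRr1 _ M)// -[X in (M `^ X)%R](@divff _ p) ?gt_eqF//.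
rewrite powRrM -powRM ?powR_ge0//; last by apply: sumr_ge0 => j _; exact: powR_ge0.
rewrite ge0_ler_powR ?nnegrE ?invr_ge0 ?(ltW p0)//.
- by apply: sumr_ge0 => j _; exact: powR_ge0.
- by rewrite mulr_ge0 ?powR_ge0//; apply: sumr_ge0 => j _; exact: powR_ge0.
rewrite mulr_sumr; apply: ler_sum => j _.
by rewrite normrM powRM// ler_wpM2r ?powR_ge0// ge0_ler_powR ?nnegrE ?(ltW p0).
Qed.

Lemma conj_index_diag (R : realType) (p : \bar R) : 0 < p -> conj_index p p = +oo.
Proof.
case: p => [p| |]//; rewrite /conj_index.
  by rewrite lte_fin => p0; rewrite inver gt_eqF// subee// inve0.
by rewrite invey oppe0 adde0 inve0.
Qed.

Lemma conj_index_fin (R : realType) (p s : R) : (0 < p)%R -> (p < s)%R ->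
  conj_index s%:E p%:E = (p^-1 - s^-1)^-1%:E.
Proof.
move=> p0 ps; have s0 := lt_trans p0 ps.
rewrite /conj_index !inver !gt_eqF// -EFinB inver gt_eqF//.
by rewrite subr_gt0 ltf_pV2 ?posrE.
Qed.

(** When s is finite and p < s, raising to the power p turns the claim into
    Hölder's inequality with the conjugate exponents q/p and s/p. If an index
    is infinite, or p = s, one of the factors is a maximum. *)
Lemma ell_norm_mul (R : realType) (p s : \bar R) (m : nat) (a b : 'I_m -> R) :
  0 < p -> p <= s ->
  (ell_norm p (fun j => a j * b j) <=
   ell_norm (conj_index s p) a * ell_norm s b)%R.
Proof.
move=> p0; rewrite le_eqVlt => /predU1P[<-|].
  by rewrite conj_index_diag//; exact: ell_normyM.
case: p p0 => [p| |]// p0; last by rewrite ltNge leey.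
case: s => [s| |]// ps; last first.
  rewrite /conj_index invey oppe0 adde0 inveK mulrC.
  under [X in ell_norm _ X]funext => j do rewrite mulrC.
  exact: ell_normyM.
rewrite !lte_fin in p0 ps; rewrite conj_index_fin//=.
set q := (p^-1 - s^-1)^-1%R; have s0 := lt_trans p0 ps.
have q0 : (0 < q)%R by rewrite invr_gt0 subr_gt0 ltf_pV2 ?posrE.
have pq : ((q / p)^-1 + (s / p)^-1 = 1)%R.
  by rewrite !invf_div -mulrDr /q invrK subrK divff ?gt_eqF.
have pVK (x t : R) : ((`|x| `^ p) `^ (t / p) = `|x| `^ t)%R.
  by rewrite -powRrM mulrCA divff ?gt_eqF// mulr1.
have pVVK (x t : R) : ((x `^ (t / p)^-1) `^ p^-1 = x `^ t^-1)%R.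
  by rewrite -powRrM invf_div mulrAC divff ?gt_eqF// mul1r.
have sum_ge0 (c : 'I_m -> R) (t : R) : (0 <= \sum_(j < m) `|c j| `^ t)%R.
  by apply: sumr_ge0 => j _; exact: powR_ge0.
rewrite -(pVVK _ q) -(pVVK _ s) -powRM ?powR_ge0//.
rewrite ge0_ler_powR ?nnegrE ?invr_ge0 ?(ltW p0) ?mulr_ge0 ?powR_ge0//.
have := @hoelder_sum R (q / p) (s / p) m (fun j => `|a j| `^ p)%R
  (fun j => `|b j| `^ p)%R (divr_gt0 q0 p0) (divr_gt0 s0 p0) pq
  (fun j => powR_ge0 _ _) (fun j => powR_ge0 _ _); rewrite /=.
under [X in (X <= _)%R -> _]eq_bigr => j _ do rewrite -powRM// -normrM.
under [X in (_ <= X `^ _ * _)%R -> _]eq_bigr => j _ do rewrite pVK.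
by under [X in (_ <= _ * X `^ _)%R -> _]eq_bigr => j _ do rewrite pVK.
Qed.

(** * Infima of scaled families *)

(** For C > 0, scaling commutes with the infimum. For C = 0 it does not when A
    is empty, since 0 times the infimum +oo is 0; a point of A then gives the
    needed bound x <= 0. *)
Lemma le_mul_ereal_inf (R : realType) (C : R) (x : \bar R) (A : set (\bar R)) :
  (0 <= C)%R -> A !=set0 -> (forall a, A a -> x <= C%:E * a) ->
  x <= C%:E * ereal_inf A.
Proof.
rewrite le_eqVlt => /predU1P[<- [a Aa] xA|C0 _ xA].
  by have := xA _ Aa; rewrite !mul0e.
rewrite -ereal_inf_pZl//; apply: le_ereal_inf_tmp => _ [a Aa <-].
exact: xA.
Qed.

(** * Weak and mixed norms *)

Lemma lip_dual_ball0 (R : realType) (X : pointedMetricType R) :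
  @lip_dual_ball R X (fun=> 0%R).
Proof.
have L0 : lipschitz_bounds (fun _ : X => 0%R : R^o) 0%R.
  by split=> // x y; rewrite mdistxx mul0r.
split; first by split=> //; exists 0%R.
apply: (@le_trans _ _ 0); last by rewrite lee01.
by apply: ereal_inf_lbound; exists 0%R.
Qed.

Lemma le_ell_weak (R : realType) (X : pointedMetricType R) (p : \bar R)
    (m : nat) (sigma : 'I_m -> R) (x' x'' : 'I_m -> X) (f : X -> R^o) :
  lip_dual_ball f ->
  (ell_norm p (fun j => sigma j * (f (x' j) - f (x'' j)))%R)%:E
    <= ell_weak p sigma x' x''.
Proof. by move=> Bf; apply: ereal_sup_ubound; exists f. Qed.

Lemma ell_weak_ge0 (R : realType) (X : pointedMetricType R) (p : \bar R)
    (m : nat) (sigma : 'I_m -> R) (x' x'' : 'I_m -> X) :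
  0 <= ell_weak p sigma x' x''.
Proof.
apply: le_trans (le_ell_weak p sigma x' x'' (@lip_dual_ball0 R X)).
by rewrite lee_fin ell_norm_ge0.
Qed.

(** This and [mixed_norm_le_weak] say that m_(s;s) is the weak norm: here
    Hölder with the weights tau in l_oo, there the weights tau = 1. *)
Lemma ell_weak_le_mixed (R : realType) (X : pointedMetricType R) (s : \bar R)
    (m : nat) (sigma : 'I_m -> R) (x' x'' : 'I_m -> X) : 0 < s ->
  ell_weak s sigma x' x'' <= mixed_norm s s sigma x' x''.
Proof.
move=> s0; apply: ge_ereal_sup => _ [f Bf <-].
apply: le_ereal_inf_tmp => _ [tau tau0 <-].
apply: le_trans (lee_wpmul2l _ (le_ell_weak _ _ _ _ Bf)); last first.
  by rewrite lee_fin ell_norm_ge0.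
rewrite -EFinM lee_fin; apply: le_trans (ell_norm_mul _ _ _ _) => //.
by under [X in (_ <= ell_norm _ X)%R]funext => j
  do rewrite mulrA mulrCA divff// mulr1.
Qed.

Lemma mixed_norm_le_weak (R : realType) (X : pointedMetricType R) (s : \bar R)
    (m : nat) (sigma : 'I_m -> R) (x' x'' : 'I_m -> X) : 0 < s ->
  mixed_norm s s sigma x' x'' <= ell_weak s sigma x' x''.
Proof.
move=> s0; apply: (@le_trans _ _ ((ell_norm (conj_index s s)
    (fun _ : 'I_m => 1%R))%:E * ell_weak s (fun j => sigma j / 1)%R x' x'')).
  by apply: ereal_inf_lbound; exists (fun=> 1%R).
under [X in ell_weak _ X]funext => j do rewrite divr1.
rewrite -[leRHS]mul1e lee_wpmul2r ?ell_weak_ge0// conj_index_diag// lee_fin /=.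
by apply: bigmax_le => // j _; rewrite normr1.
Qed.

(** * Summing operators *)

(** Every (s, m(s;s)) estimate self-improves to a (p, m(s;p)) estimate with the
    same constant, because it can be applied to all the reweighted sequences
    sigma / tau that compete in the mixed norm. *)
Lemma bounds_p_m_mixed (R : realType) (Y Z : pointedMetricType R)
    (p s : \bar R) (T : Y -> Z) : 0 < p -> p <= s ->
  bounds_p_m s s s T `<=` bounds_p_m p s p T.
Proof.
move=> p0 ps C [C0 TC]; split=> // m sigma y' y''.
apply: le_mul_ereal_inf => //.
  by eexists; exists (fun=> 1%R).
move=> _ [tau tau0 <-]; rewrite muleCA.
have s0 : 0 < s := lt_le_trans p0 ps.
have Tweak : ell_mdist s (fun j => sigma j / tau j)%R (T \o y') (T \o y'')
    <= C%:E * ell_weak s (fun j => sigma j / tau j)%R y' y''.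
  by apply: le_trans (TC _ _ _ _) _; rewrite lee_wpmul2l ?mixed_norm_le_weak.
apply: le_trans (lee_wpmul2l _ Tweak); last by rewrite lee_fin ell_norm_ge0.
rewrite /ell_mdist -EFinM lee_fin.
apply: le_trans (ell_norm_mul _ _ _ _) => //.
by under [X in (_ <= ell_norm _ X)%R]funext => j
  do rewrite mulrA mulrCA divff// mulr1.
Qed.

Lemma bounds_p_m_comp (R : realType) (X Y Z : pointedMetricType R)
    (p s r : \bar R) (S : X -> Y) (T : Y -> Z) (CT CS : R) :
  0 < p -> p <= s -> 0 < r ->
  bounds_p_m s s s T CT -> bounds_m_p s p r S CS ->
  bounds_p_m p r r (T \o S) (CT * CS)%R.
Proof.
move=> p0 ps r0 /(bounds_p_m_mixed p0 ps)[CT0 TC] [CS0 SC].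
split=> [|m sigma x' x'']; first exact: mulr_ge0.
apply: le_trans (TC m sigma (S \o x') (S \o x'')) _.
rewrite EFinM -muleA lee_wpmul2l ?lee_fin//.
apply: le_trans (SC _ _ _ _) _; rewrite lee_wpmul2l ?lee_fin//.
exact: ell_weak_le_mixed.
Qed.

Lemma is_lipschitz_comp (R : realType) (X Y Z : metricType R)
    (S : X -> Y) (T : Y -> Z) :
  is_lipschitz S -> is_lipschitz T -> is_lipschitz (T \o S).
Proof.
move=> [K [K0 SK]] [L [L0 TL]]; exists (L * K)%R; split=> [|x y].
  exact: mulr_ge0.
by apply: le_trans (TL _ _) _; rewrite -mulrA ler_wpM2l.
Qed.

Theorem theorem4p4 (R : realType) (X Y Z : pointedMetricType R)
    (p s r : \bar R) (p_gt0 : 0 < p) (le_ps : p <= s)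
    (r_gt0 : 0 < r) (le_rp : r <= p)
    (S : X -> Y) (T : Y -> Z) :
  Pi_m_p s p r S ->
  Pi_p_m s s s T ->
  Pi_p_m p r r (T \o S) /\
  pi_p_m p r r (T \o S) <= pi_p_m s s s T * pi_m_p s p r S.
Proof.
move=> [lipS [CS SCS]] [lipT [CT TCT]].
split.
  split; first exact: is_lipschitz_comp.
  by exists (CT * CS)%R; exact: bounds_p_m_comp TCT SCS.
have piS_ge0 : 0 <= pi_m_p s p r S.
  by apply: le_ereal_inf_tmp => _ [C [C0 _] <-]; rewrite lee_fin.
have piS_fin : pi_m_p s p r S \is a fin_num.
  rewrite ge0_fin_numE//; apply: (@le_lt_trans _ _ CS%:E); last exact: ltry.
  by apply: ereal_inf_lbound; exists CS.
(* Each infimum is pulled out while the other factor is a fixed real number: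
   first over the constants of T, then, for each of them, over those of S. *)
rewrite muleC -(fineK piS_fin); apply: le_mul_ereal_inf.
- exact: fine_ge0.
- by exists CT%:E; exists CT.
move=> _ [C TC <-]; rewrite (fineK piS_fin) muleC.
apply: le_mul_ereal_inf; first by case: TC.
  by exists CS%:E; exists CS.
move=> _ [D SD <-]; apply: ereal_inf_lbound; exists (C * D)%R => //.
exact: bounds_p_m_comp TC SD.
Qed.
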